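(* Let $(\mathbb{X},\|\cdot\|)$ be a real Banach space and let $f:\mathbb{X}\longrightarrow\mathbb{R}$ be lower semicontinuous on $\mathbb{X}$ and bounded from below. Suppose that $f$ is quasidifferentiable at each point of $\mathbb{X}$ and that $$\mathrm{dist}\left(\mathbf{0}^*,\bigcup_{x\in\mathbb{X}\backslash\mathrm{Argmin}(f)}\mathcal{D}^{\vartriangle}f(x)\right)=\tau>0.$$ Then $f$ admits global weak sharp minimizers and $\mathrm{wsha}(f)\ge\tau$.
   Context: $\mathbb{X}^*$ is the topological dual of $\mathbb{X}$ with null functional $\mathbf{0}^*$, and $\langle\cdot,\cdot\rangle$ is the duality pairing. In a normed space, $\mathrm{dist}(x,A)=\inf_{a\in A}\|x-a\|$, with $\mathrm{dist}(x,\varnothing)=+\infty$. $\mathcal{K}(\mathbb{X}^* )$ denotes the family of all nonempty, convex, weak* compact subsets of $\mathbb{X}^*$; for $A\in\mathcal{K}(\mathbb{X}^* )$ its support function is $\varsigma(v,A)=\max_{x^*\in A}\langle x^*,v\rangle$, $v\in\mathbb{X}$. Quasidifferentiability: $f$ is quasidifferentiable at $x$ if it admits a directional derivative $f'(x;v)$ at $x$ in every direction $v$ and there exist $\underline{\partial}f(x),\,-\overline{\partial}f(x)\in\mathcal{K}(\mathbb{X}^* )$ such that $f'(x;v)=\varsigma(v,\underline{\partial}f(x))-\varsigma(v,-\overline{\partial}f(x))$ for all $v\in\mathbb{X}$ (equivalently, $f'(x;\cdot)$ is a difference of two continuous sublinear functions). Demyanov difference: for $A,B\in\mathcal{K}(\mathbb{X}^*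 )$, $A\,\underline{\vartriangle}\,B=\partial^\circ\big(\varsigma(\cdot,A)-\varsigma(\cdot,B)\big)(\mathbf{0})$, where $\partial^\circ$ is the Clarke subdifferential and $\mathbf{0}$ the null vector of $\mathbb{X}$. Set $\mathcal{D}^{\vartriangle}f(x)=\underline{\partial}f(x)\,\underline{\vartriangle}\,(-\overline{\partial}f(x))$; this set does not depend on the choice of the representing pair. Weak sharpness: put $\underline{\alpha}=\inf_{x\in\mathbb{X}}f(x)$ and $\mathrm{Argmin}(f)=\{x\in\mathbb{X}: f(x)\le\underline{\alpha}\}$. The function $f$ admits global weak sharp minimizers if $\mathrm{Argmin}(f)\ne\varnothing$ and there exists $\sigma>0$ such that $\sigma\cdot\mathrm{dist}(x,\mathrm{Argmin}(f))\le f(x)-\underline{\alpha}$ for every $x\in\mathbb{X}$. The supremum of all such $\sigma$ is denoted by $\mathrm{wsha}(f)$. *)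

(* Defs.v *)
From HB Require Import structures.
From mathcomp Require Import all_boot all_order all_algebra.
From mathcomp Require Import all_classical all_reals all_analysis.

Set Implicit Arguments.
Unset Strict Implicit.
Unset Printing Implicit Defensive.
Import Order.TTheory GRing.Theory Num.Theory.
Import numFieldNormedType.Exports.

Local Open Scope classical_set_scope.
Local Open Scope ring_scope.

(* [N] is the norm with respect to which the distance is measured. Values are
   extended reals: the distance to the empty set is +oo. *)
Definition dist (R : realType) (V : zmodType) (N : V -> \bar R) (x : V)
    (A : set V) : \bar R :=
  ereal_inf [set N (x - a) | a in A].

Section Dual.
Context {R : realType} {X : normedModType R}.

(* The topological dual is a set of functions, so that the null functional is
   [0 : X -> R^o] and the weak* topology is the one induced by the topology of
   pointwise convergence on [{ptws X -> R^o}]. *)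
Definition dual : set (X -> R^o) := [set p | linear p /\ continuous p].

Definition dual_norm (p : X -> R^o) : \bar R :=
  ereal_sup [set `|p v|%:E | v in [set v : X | `|v| <= 1]].

(* Compactness of a subset of the dual does not depend on whether it is taken
   in the dual or in the ambient space [{ptws X -> R^o}]. *)
Definition weak_star_compact (A : set (X -> R^o)) : Prop :=
  A `<=` dual /\ compact (A : set {ptws X -> R^o}).

Definition in_K (A : set (X -> R^o)) : Prop :=
  [/\ A !=set0, convex_set A & weak_star_compact A].

(* For [A] in the family [in_K] the supremum is a maximum. *)
Definition support (A : set (X -> R^o)) (v : X) : R :=
  sup [set p v | p in A].

End Dual.

Section Subdifferentials.
Context {R : realType} {X : normedModType R}.
Implicit Types (f h : X -> R) (x v : X) (A B : set (X -> R^o)).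

Definition diff_quot f v x (t : R) : R := t^-1 * (f (x + t *: v) - f x).

(* One-sided directional derivative, unlike the library's ['D_v f x]. *)
Definition has_dirderiv f x v (d : R) : Prop :=
  diff_quot f v x t @[t --> 0^'+] --> d.

Definition dirderiv f x v : R := lim (diff_quot f v x t @[t --> 0^'+]).

Definition clarke_dirderiv h x v : \bar R :=
  limf_esup (fun yt : X * R => (diff_quot h v yt.1 yt.2)%:E)
    (filter_prod (nbhs x) (0 : R)^'+).

Definition clarke_subdiff h x : set (X -> R^o) :=
  [set p | dual p /\ forall v, ((p v : R)%:E <= clarke_dirderiv h x v)%E].

Definition demyanov_diff A B : set (X -> R^o) :=
  clarke_subdiff (fun v => support A v - support B v) 0.

(* [U] and [O] are the lower and the upper quasidifferential; as in the usual
   sign convention, it is [-O] that is represented by its support function. *)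
Definition quasidiff_pair f x (U O : set (X -> R^o)) : Prop :=
  [/\ in_K U, in_K (-%R @` O) &
      forall v, dirderiv f x v = support U v - support (-%R @` O) v].

Definition quasidifferentiable f x : Prop :=
  (forall v, exists d, has_dirderiv f x v d) /\
  exists U O, quasidiff_pair f x U O.

(* Computed from an arbitrarily chosen representing pair; the choice does not
   matter by [demyanov_subdiffE]. *)
Definition demyanov_subdiff f x : set (X -> R^o) :=
  let UO := get [set UO | quasidiff_pair f x UO.1 UO.2] in
  demyanov_diff UO.1 (-%R @` UO.2).

Lemma demyanov_subdiffE f x U O : quasidiff_pair f x U O ->
  demyanov_subdiff f x = demyanov_diff U (-%R @` O).
Proof.
move=> fUO; rewrite /demyanov_subdiff /demyanov_diff.
set UO := get _.
have [_ _ E] : quasidiff_pair f x UO.1 UO.2.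
  exact: (@getPex _ [set UO | quasidiff_pair f x UO.1 UO.2]
    (ex_intro _ (U, O) fUO)).
have [_ _ E'] := fUO.
by congr clarke_subdiff; apply/funext => v; rewrite -E -E'.
Qed.

End Subdifferentials.

Section WeakSharp.
Context {R : realType} {X : normedModType R}.
Implicit Types (f : X -> R).
Local Open Scope ereal_scope.

Definition infval f : \bar R := ereal_inf [set (f x)%:E | x in setT].

Definition Argmin f : set X := [set x | (f x)%:E <= infval f].

Definition weak_sharp_constant f (s : R) : Prop :=
  (0 < s)%R /\
  forall x, s%:E * dist (fun v : X => `|v|%:E) x (Argmin f)
            <= (f x)%:E - infval f.

Definition weak_sharp f : Prop :=
  Argmin f !=set0 /\ exists s : R, weak_sharp_constant f s.

Definition wsha f : \bar R :=
  ereal_sup [set s%:E | s in [set s | weak_sharp_constant f s]].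

End WeakSharp.

(* Main.v *)
Require Import Defs.
From mathcomp Require Import all_boot all_order all_algebra.
From mathcomp Require Import all_classical all_reals all_analysis.
From mathcomp Require Import ring lra.

Set Implicit Arguments.
Unset Strict Implicit.
Unset Printing Implicit Defensive.
Import Order.TTheory GRing.Theory Num.Theory.
Import numFieldNormedType.Exports.

Local Open Scope classical_set_scope.
Local Open Scope ring_scope.

(** Weak sharpness is read off a slope condition: if at every non-minimizer
    [f] descends in some direction at a rate larger than [s], then starting from
    any [x0] one can travel to a minimizer, gaining at least [s] per unit of
    length, so that [s * dist x0 Argmin <= f x0 - inf f]. Ekeland's variational
    principle does the travelling in one step: it yields [a] with
    [f a + s * `|a - x0| <= f x0] at which [f + s * `|_ - a|] is minimal
    ([ekeland]).

    If such an [a] were not a minimizer of [f], the Demyanov subdifferential of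
    [f] at [a] would contain an element of norm at most [s], which is impossible
    for [s < tau]. Indeed minimality gives [f'(a; v) >= - s * `|v|] for all [v],
    i.e. the origin minimizes [h + s * `|_|], where [h = f'(a; _)] is the very
    difference of support functions whose Clarke subdifferential at the origin
    is the Demyanov subdifferential. The Clarke subdifferential of [h] then
    meets the ball of radius [s] ([clarke_slope_bound]), by Hahn-Banach: a
    linear form is wanted below both the Clarke derivative of [h] and the
    function [s * `|_|].

    The Clarke derivative may take infinite values, so Hahn-Banach is stated not
    for sublinear functions but for convex cones in [X * R], seen as sets of
    constraints [p v <= c] ([hahn_banach_cone]). Subadditivity of the Clarke
    derivative becomes additivity of its eventual upper bounds. *)

(** * Hahn-Banach theorem for convex cones *)

Section HahnBanach.
Context {R : realType} {X : lmodType R}.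
Implicit Types (E M : set (X * R)) (u v w : X) (c d t : R).

(** A point [(v, c)] of the cone stands for the constraint [p v <= c] on an
    unknown linear form [p]; the last condition is its consistency at [0]. *)
Definition proper_cone E :=
  [/\ E (0, 0), forall v w c d, E (v, c) -> E (w, d) -> E (v + w, c + d),
      forall t v c, 0 < t -> E (v, c) -> E (t *: v, t * c) &
      forall c, E (0, c) -> 0 <= c].

(** Zorn's lemma applies because the conditions defining a proper cone involve
    at most two points at a time, and two points of the union of a chain already
    lie in one member of the chain. *)
Lemma maximal_proper_cone E : proper_cone E ->
  exists M, [/\ proper_cone M, E `<=` M &
    forall B, proper_cone B -> M `<=` B -> B `<=` M].
Proof.
move=> coneE.
(* The union with [E] makes the empty chain harmless. *)
have [F FP Ftot|A [PA maxA]] := @Zorn_bigcup _ [set A | proper_cone (E `|` A)].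
  have inside v c w d : (E `|` \bigcup_(A in F) A) (v, c) ->
      (E `|` \bigcup_(A in F) A) (w, d) ->
      exists A, [/\ proper_cone (E `|` A),
        (E `|` A) `<=` E `|` \bigcup_(A in F) A,
        (E `|` A) (v, c) & (E `|` A) (w, d)].
    have sub A : F A -> (E `|` A) `<=` E `|` \bigcup_(A in F) A.
      by move=> FA z [Ez|Az]; [left|right; exists A].
    move=> [Ev|[A FA Av]] [Ew|[B FB Bw]].
    - by exists set0; rewrite setU0; split => //; exact: subsetUl.
    - by exists B; split; [exact: FP|exact: sub|left|right].
    - by exists A; split; [exact: FP|exact: sub|right|left].
    - have [AB|BA] := Ftot _ _ FA FB.
      + by exists B; split; [exact: FP|exact: sub|right; exact: AB|right].
      + by exists A; split; [exact: FP|exact: sub|right|right; exact: BA].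
  split=> [|v w c d Ev Ew|t v c t0 Ev|c Ec].
  - by left; case: coneE.
  - have [A [[_ addA _ _] subA Av Aw]] := inside _ _ _ _ Ev Ew.
    exact/subA/addA.
  - have [A [[_ _ scaleA _] subA Av _]] := inside _ _ _ _ Ev Ev.
    exact/subA/scaleA.
  - by have [A [[_ _ _ posA] _ Ac _]] := inside _ _ _ _ Ec Ec; exact: posA.
exists (E `|` A); split => // B coneB EAB.
have PB : proper_cone (E `|` B).
  by rewrite setUidr// => z Ez; apply: EAB; left.
have [BA|nBA] := pselect (B `<=` A); first by move=> z /BA; right.
exfalso; apply: (maxA B) => //; split => //.
by move=> z Az; apply: EAB; right.
Qed.

(** The infimum of the fibres of a maximal cone is a sublinear function [p].
    Maximality forces it to be odd, hence linear, since the constraint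
    [p u <= - p (- u)] can be added without losing consistency. Nonempty fibres
    also bound each other from below: those at [v] and [- v] add up to points
    above [0]. *)
Lemma hahn_banach_cone E : proper_cone E -> (forall v, exists c, E (v, c)) ->
  exists p : X -> R^o, linear p /\ forall v c, E (v, c) -> p v <= c.
Proof.
move=> /maximal_proper_cone[M [[M0 addM scaleM posM] EM maxM]] fibreE.
pose p v : R := inf [set c | M (v, c)].
have fibreM v : [set c | M (v, c)] !=set0.
  by have [c /EM Mc] := fibreE v; exists c.
have lbM v : has_lbound [set c | M (v, c)].
  have [d Md] := fibreM (- v); exists (- d) => c /= Mc.
  by rewrite -subr_ge0 opprK; apply: posM; rewrite -(subrr v); exact: addM.
have p_le v c : M (v, c) -> p v <= c by move=> Mc; exact: (ge_inf (lbM v)).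
have le_p v d : (forall c, M (v, c) -> d <= c) -> d <= p v.
  by move=> h; exact: (lb_le_inf (fibreM v)).
have pD v w : p (v + w) <= p v + p w.
  rewrite -lerBlDr; apply: (le_p _ _) => c Mc; rewrite lerBlDr -lerBlDl.
  by apply: (le_p _ _) => d Md; rewrite lerBlDl; apply: (p_le _ _); exact: addM.
have pZ t v : 0 < t -> p (t *: v) <= t * p v.
  move=> t0; rewrite -ler_pdivrMl//; apply: (le_p _ _) => c Mc.
  by rewrite ler_pdivrMl//; apply: (p_le _ _); exact: scaleM.
have pN u : p (- u) = - p u.
  apply/eqP; rewrite eq_le; apply/andP; split; last first.
    rewrite -subr_ge0 opprK addrC; apply: le_trans (pD _ _).
    by rewrite subrr; apply: (le_p _ _) => c; exact: posM.
  (* The cone generated by [M] and the ray through [(u, - p (- u))]. *)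
  pose B := [set z | exists v c t,
    [/\ M (v, c), 0 <= t & z = (v + t *: u, c - t * p (- u))]].
  rewrite lerNr; apply: (p_le _ _); apply: (maxM B).
  - split=> [|_ _ _ _ [v [c [t [Mv t0 [-> ->]]]]] [w [d [r [Mw r0 [-> ->]]]]]
            |r _ _ r0 [v [c [t [Mv t0 [-> ->]]]]]
            |_ [v [c [t [Mv t0 [/esym/eqP v0 ->]]]]]].
    + by exists 0, 0, 0; rewrite scale0r addr0 mul0r subr0.
    + exists (v + w), (c + d), (t + r); split; [exact: addM|exact: addr_ge0|].
      by rewrite scalerDl addrACA; congr pair; ring.
    + exists (r *: v), (r * c), (r * t); split.
      * exact: scaleM.
      * by rewrite mulr_ge0// ltW.
      * by rewrite scalerDr scalerA mulrBr mulrA.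
    + move: v0; rewrite addr_eq0 => /eqP v0.
      rewrite subr_ge0; move: t0; rewrite le_eqVlt => /predU1P[t0|t0].
        rewrite -t0 mul0r; apply: posM.
        by move: Mv; rewrite v0 -t0 scale0r oppr0.
      rewrite -ler_pdivlMl//; apply: p_le.
      suff -> : - u = t^-1 *: v by apply: scaleM; rewrite ?invr_gt0.
      by rewrite v0 -scalerN scalerA mulVf ?scale1r// gt_eqF.
  - by move=> [v c] Mv; exists v, c, 0; rewrite scale0r addr0 mul0r subr0.
  - by exists 0, 0, 1; rewrite ler01 scale1r add0r sub0r mul1r.
have pZN t v : 0 < t -> p (t *: v) = t * p v.
  move=> t0; apply/eqP; rewrite eq_le pZ//=.
  by have := pZ t (- v) t0; rewrite scalerN !pN mulrN lerN2.
have p0 : p 0 = 0 by have := pN 0; rewrite oppr0; lra.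
exists p; split=> [a v w|v c /EM]; last exact: p_le.
rewrite /GRing.scale/=.
have -> : p (a *: v + w) = p (a *: v) + p w.
  apply/eqP; rewrite eq_le pD/=.
  by have := pD (- (a *: v)) (- w); rewrite -opprD !pN -opprD lerN2.
congr +%R; have [a0|a0|->] := ltgtP a 0; last by rewrite scale0r mul0r.
  by rewrite -[in LHS](opprK a) scaleNr pN pZN ?oppr_gt0// mulNr opprK.
exact: pZN.
Qed.
End HahnBanach.

(** * Clarke subgradients of controlled norm *)

Section Clarke.
Context {R : realType} {X : normedModType R}.
Implicit Types (h : X -> R) (x v w y : X) (c d s t : R).

(** Eventual upper bounds of the difference quotients: [clarke_dirderiv h x v] is
    their infimum, possibly infinite, but they are real numbers, which can be
    added and scaled. *)
Definition clarke_ubound h x v c :=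
  \forall yt \near filter_prod (nbhs x) (0 : R)^'+,
    diff_quot h v yt.1 yt.2 <= c.

Lemma le_clarke_dirderiv h x v r :
  (forall c, clarke_ubound h x v c -> r <= c) ->
  (r%:E <= clarke_dirderiv h x v)%E.
Proof.
move=> rle; apply: le_ereal_inf_tmp => _ [V FV <-].
have ubV yt : V yt -> ((diff_quot h v yt.1 yt.2)%:E <=
    ereal_sup [set (diff_quot h v zt.1 zt.2)%:E | zt in V])%E.
  by move=> Vyt; apply: ereal_sup_ubound; exists yt.
case: ereal_sup ubV => [c| |] ubV; last 2 first.
- exact: leey.
- by have [yt /ubV] := filter_ex FV.
rewrite lee_fin; apply: rle.
by apply: filterS FV => yt /ubV; rewrite lee_fin.
Qed.

(** The quotient along [v + w] at [y] is the quotient along [w] at [y] plus the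
    quotient along [v] at [y + t *: w]. The moving base point of the Clarke
    derivative absorbs this shift. *)
Lemma clarke_uboundD h x v w c d :
  clarke_ubound h x v c -> clarke_ubound h x w d ->
  clarke_ubound h x (v + w) (c + d).
Proof.
move=> hc hd.
have shift : (yt.1 + yt.2 *: w, yt.2) @[yt --> filter_prod (nbhs x) (0 : R)^'+]
    --> filter_prod (nbhs x) (0 : R)^'+.
  apply: (@cvg_pair _ _ _ _ (nbhs x) (0 : R)^'+ _ _ _
    (fun yt => yt.1 + yt.2 *: w) snd _ cvg_snd).
  rewrite -[X in _ --> nbhs X]addr0 -[X in _ + X](scale0r w).
  apply: cvgD; first exact: cvg_fst.
  apply: cvgZl; apply: (@cvg_trans _ ((0 : R)^'+)); first exact: cvg_snd.
  exact: cvg_at_right_filter.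
have hc' := shift _ hc.
near=> yt.
have -> : diff_quot h (v + w) yt.1 yt.2 =
    diff_quot h v (yt.1 + yt.2 *: w) yt.2 + diff_quot h w yt.1 yt.2.
  rewrite /diff_quot -mulrDr addrA subrK; congr (_ * (h _ - _)).
  by rewrite scalerDr addrA addrAC.
by apply: lerD; near: yt.
Unshelve. all: by end_near. Qed.

Lemma clarke_uboundZ h x v c r : 0 < r ->
  clarke_ubound h x v c -> clarke_ubound h x (r *: v) (r * c).
Proof.
move=> r0 hc.
have cont : r * t @[t --> (0 : R)] --> (0 : R).
  by have := @mulrl_continuous R r 0; rewrite /continuous_at mulr0.
have scale_right : r * t @[t --> (0 : R)^'+] --> (0 : R)^'+.
  move=> A A0; have {}A0 : nbhs (0 : R) (fun t => 0 < t -> A t) := A0.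
  suff : nbhs (0 : R) (fun t => 0 < t -> A (r * t)) by [].
  have : nbhs (0 : R) (fun t => 0 < r * t -> A (r * t)) := cont _ A0.
  by apply: filterS => t At t0; apply: At; rewrite mulr_gt0.
have scale : (yt.1, r * yt.2) @[yt --> filter_prod (nbhs x) (0 : R)^'+]
    --> filter_prod (nbhs x) (0 : R)^'+.
  exact: (@cvg_pair _ _ _ _ (nbhs x) (0 : R)^'+ _ _ _
    fst (fun yt => r * yt.2) cvg_fst (cvg_comp _ _ cvg_snd scale_right)).
have hc' := scale _ hc.
near=> yt.
have -> : diff_quot h (r *: v) yt.1 yt.2 = r * diff_quot h v yt.1 (r * yt.2).
  rewrite /diff_quot scalerA (mulrC r yt.2) invfM mulrA mulrCA.
  by rewrite mulfV ?mulr1// gt_eqF.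
by rewrite ler_pM2l//; near: yt.
Unshelve. all: by end_near. Qed.

(** The base point [x] itself takes part in the Clarke derivative at [x]. *)
Lemma clarke_ubound_radial h x v c s :
  (forall t, 0 < t -> h x + t * s <= h (x + t *: v)) ->
  clarke_ubound h x v c -> s <= c.
Proof.
move=> hs [[A B] /= [Ax B0] AB].
have [t [Bt t0]] : exists t, B t /\ 0 < t.
  apply: (@filter_ex _ (0 : R)^'+).
  by near=> t; split; near: t; [|exact: nbhs_right_gt].
have := AB (x, t) (conj (nbhs_singleton Ax) Bt).
apply: le_trans; rewrite /diff_quot/= ler_pdivlMl// lerBrDl.
exact: hs.
Unshelve. all: by end_near. Qed.

Lemma linear_bounded_dual (p : X -> R^o) s : 0 <= s -> linear p ->
  (forall v, p v <= s * `|v|) -> dual p /\ (dual_norm p <= s%:E)%E.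
Proof.
move=> s0 linp ps.
have pB v w : p (v - w) = p v - p w.
  by rewrite addrC -scaleN1r linp scaleN1r addrC.
have pN v : p (- v) = - p v by rewrite -sub0r pB -[in LHS](subrr v) pB; lra.
have absp v : `|p v| <= s * `|v|.
  by rewrite ler_norml ps andbT lerNl -pN -(normrN v).
split; last first.
  apply: ge_ereal_sup => _ [v /= v1 <-]; rewrite lee_fin.
  by apply: le_trans (absp v) _; rewrite -[leRHS]mulr1 ler_wpM2l.
split => // x; apply/cvgrPdist_lt => e e0; near=> y.
rewrite -pB; apply: le_lt_trans (absp _) _.
apply: (@le_lt_trans _ _ ((s + 1) * `|x - y|)).
  by rewrite ler_wpM2r//; lra.
rewrite -ltr_pdivlMl ?ltr_wpDl//; near: y.
by apply: cvgr_dist_lt => //; rewrite mulr_gt0// invr_gt0 ltr_wpDl.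
Unshelve. all: by end_near. Qed.

(** Fermat's rule combined with the sum rule for [h + s * `|_ - x|]. The
    constraints [p v <= c], for [c] an upper bound in the sense of
    [clarke_ubound], and [p v <= s * `|v|] generate a cone; it is proper because
    the minimality of [x] puts every [c] above [- (s * `|v|)]. *)
Lemma clarke_slope_bound h x s : 0 <= s ->
  (forall y, h x <= h y + s * `|y - x|) ->
  exists p, clarke_subdiff h x p /\ (dual_norm p <= s%:E)%E.
Proof.
move=> s0 xmin.
have ub_ge v c : clarke_ubound h x v c -> - (s * `|v|) <= c.
  apply: clarke_ubound_radial => t t0; have := xmin (x + t *: v).
  by rewrite [x + _]addrC addrK normrZ gtr0_norm// mulrN mulrCA; lra.
have ub00 : clarke_ubound h x 0 0.
  by near=> yt; rewrite /diff_quot scaler0 addr0 subrr mulr0.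
pose E := [set z | exists w c, clarke_ubound h x w c /\
                               c + s * `|z.1 - w| <= z.2].
have E_norm v : E (v, s * `|v|) by exists 0, 0; rewrite /= subr0 add0r.
have E_ub v c : clarke_ubound h x v c -> E (v, c).
  by exists v, c; rewrite /= subrr normr0 mulr0 addr0.
have [||p [linp p_le]] := @hahn_banach_cone R X E.
- split => [|v v' c c' [w [d [wd /= cE]]] [w' [d' [wd' /= cE']]]
            |t v c t0 [w [d [wd /= cE]]]|c [w [d [wd /= cE]]]].
  + exact: E_ub.
  + exists (w + w'), (d + d'); split; first exact: clarke_uboundD.
    apply: le_trans (lerD cE cE'); rewrite /= addrACA lerD2l -mulrDr.
    by rewrite ler_wpM2l// opprD addrACA ler_normD.
  + exists (t *: w), (t * d); split; first exact: clarke_uboundZ.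
    by rewrite /= -scalerBr normrZ gtr0_norm// mulrCA -mulrDr ler_pM2l.
  + by have := ub_ge _ _ wd; move: cE; rewrite sub0r normrN; lra.
- by move=> v; exists (s * `|v|).
have [dualp normp] :=
  linear_bounded_dual s0 linp (fun v => p_le _ _ (E_norm v)).
exists p; split => //; split => // v.
by apply: le_clarke_dirderiv => c /E_ub; exact: p_le.
Unshelve. all: by end_near. Qed.
End Clarke.

(** * Ekeland's variational principle *)

Section Ekeland.
Context {R : realType} {X : completeNormedModType R}.
Implicit Types (f : X -> R) (x y : X).

(** Write [S x y] for [f y + s * `|y - x| <= f x]: the move from [x] to [y]
    gains at least [s] per unit of length. This is a preorder. Starting from
    [x0], move repeatedly to an almost optimal point among those reachable: total length is
    controlled by the total gain, so the moves converge, and the limit can be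
    improved no further, as anything reachable from it was reachable from each
    point before it. *)
Lemma ekeland f s x0 : 0 < s ->
  lower_semicontinuous (fun x => (f x)%:E) ->
  has_lbound [set f x | x in setT] ->
  exists x, f x + s * `|x - x0| <= f x0 /\
            forall y, f x <= f y + s * `|y - x|.
Proof.
move=> s0 f_lsc [b fb].
have {}fb x : b <= f x by apply: fb; exists x.
pose S x y := f y + s * `|y - x| <= f x.
have Srefl x : S x x by rewrite /S subrr normr0 mulr0 addr0.
have Strans x y z : S x y -> S y z -> S x z.
  have : s * `|z - x| <= s * `|z - y| + s * `|y - x|.
    by rewrite -mulrDr (ler_wpM2l (ltW s0))// ler_distD.
  rewrite /S; lra.
have almost_min (nx : nat * X) : exists y, S nx.2 y /\
    forall z, S nx.2 z -> f y <= f z + nx.1.+1%:R^-1.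
  case: nx => n x /=; pose I := [set f z | z in S x].
  have I0 : I !=set0 by exists (f x), x.
  have Ib : has_lbound I by exists b => _ [z _ <-].
  have [|_ [y Sy <-] yI] := @inf_adherent _ I n.+1%:R^-1 _ (conj I0 Ib).
    by rewrite invr_gt0.
  exists y; split => // z Sz; apply: le_trans (ltW yI) _; rewrite lerD2r.
  by apply: ge_inf => //; exists z.
have [next nextP] := choice almost_min.
pose u := fix u n := if n is m.+1 then next (m, u m) else x0.
have uS n k : S (u n) (u (n + k)%N).
  elim: k => [|k IH]; first by rewrite addn0.
  by rewrite addnS; apply: Strans IH _; exact: (nextP (_, _)).1.
have u_cauchy : cauchy (u @ \oo).
  apply: cauchy_exP => e e0; pose I := range (f \o u).
  have I0 : I !=set0 by exists (f (u 0)), 0.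
  have Ib : has_lbound I by exists b => _ [z _ <-]; exact: fb.
  have [|_ [n _ <-] /= nI] := @inf_adherent _ I (s * e) _ (conj I0 Ib).
    exact: mulr_gt0.
  (* The gain still available after step [n] is below [s * e]. *)
  exists (u n); exists n => // m /= nm; rewrite -ball_normE/= distrC.
  have := uS n (m - n)%N; rewrite subnKC// /S => Sm.
  have : inf I <= f (u m) by apply: ge_inf => //; exists m.
  rewrite -(ltr_pM2l s0) => ?; lra.
have [x ux] := (cvg_ex _).1 (cauchy_cvg _ u_cauchy).
(* The sets [S (u n)] are closed, by lower semicontinuity. *)
have limS n : S (u n) x.
  apply/ler_addgt0Pr => e e0.
  have [V Vx fV] : exists2 V, nbhs x V &
      forall y, V y -> ((f x - e / 2)%:E < (f y)%:E)%E.
    by apply: f_lsc; rewrite lte_fin; lra.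
  have [m [Vm xm nm]] :
      exists m, [/\ V (u m), `|x - u m| < e / 2 / s & (n <= m)%N].
    apply: (@filter_ex _ \oo); near=> m; split; near: m.
    - exact: ux.
    - by move/cvgrPdist_lt: ux; apply; rewrite !divr_gt0.
    - exact: nbhs_infty_ge.
  have := uS n (m - n)%N; rewrite subnKC// /S => Sm.
  have {fV Vm} := fV _ Vm; rewrite lte_fin.
  move: xm; rewrite ltr_pdivlMr// mulrC.
  have : s * `|x - u n| <= s * `|x - u m| + s * `|u m - u n|.
    by rewrite -mulrDr (ler_wpM2l (ltW s0))// ler_distD.
  lra.
exists x; split => [|y]; first exact: (limS 0).
rewrite leNgt; apply/negP => Sy.
have Sny n : S (u n) y by exact: Strans (limS n) (ltW Sy).
have : f x <= f y.
  apply/ler_addgt0Pr => e e0.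
  near \oo => n.
  have := (nextP (n, u n)).2 y (Sny n) => /= fn.
  have := limS n.+1; rewrite /S /= => limn.
  apply: le_trans (le_trans _ limn) (le_trans fn _).
    by rewrite lerDl mulr_ge0// ltW.
  by rewrite lerD2l ltW//; near: n; exact: near_infty_natSinv_lt (PosNum e0).
have : 0 <= s * `|y - x| by rewrite mulr_ge0// ltW.
by lra.
Unshelve. all: by end_near. Qed.
End Ekeland.

(** * From quasidifferentials to weak sharp minimizers *)

Lemma dirderiv_ge {R : realType} {X : normedModType R} (f : X -> R) x v d s :
  has_dirderiv f x v d ->
  (forall t, 0 < t -> f x + t * s <= f (x + t *: v)) -> s <= dirderiv f x v.
Proof.
move=> fd fs; rewrite /dirderiv; apply: limr_ge.
  by apply/cvg_ex; exists d.
near=> t; have t0 : 0 < t by near: t; exact: nbhs_right_gt.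
by rewrite /diff_quot ler_pdivlMl// lerBrDl; exact: fs.
Unshelve. all: by end_near. Qed.

(** The difference of support functions that defines the Demyanov
    subdifferential equals [f'(x; _)], which vanishes at [0] and inherits the
    lower bound [- s * `|_|] from the minimality of [x]. *)
Lemma small_demyanov_subgradient {R : realType} {X : normedModType R}
    (f : X -> R) x s : 0 <= s -> quasidifferentiable f x ->
  (forall y, f x <= f y + s * `|y - x|) ->
  exists p, demyanov_subdiff f x p /\ (dual_norm p <= s%:E)%E.
Proof.
move=> s0 [fd [U [V UV]]] xmin; rewrite (demyanov_subdiffE UV) /demyanov_diff.
have [_ _ fE] := UV.
have -> : (fun v => Defs.support U v - Defs.support (-%R @` V) v)
    = dirderiv f x.
  by apply/funext => v; rewrite fE.
have f0 : dirderiv f x 0 = 0.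
  rewrite /dirderiv; apply: cvg_lim => //.
  rewrite (_ : diff_quot f 0 x = cst 0); first exact: cvg_cst.
  by apply/funext => t; rewrite /diff_quot scaler0 addr0 subrr mulr0.
apply: clarke_slope_bound => // v; rewrite f0 subr0 -lerBlDr sub0r.
have [d fvd] := fd v; apply: (dirderiv_ge fvd) => t t0.
have := xmin (x + t *: v); rewrite [x + _]addrC addrK normrZ gtr0_norm//.
by rewrite mulrN mulrCA; lra.
Qed.

Lemma pos_fin_between {R : realType} (a : \bar R) : (0 < a)%E ->
  exists s : R, 0 < s /\ (s%:E < a)%E.
Proof.
case: a => [a| |] //; last by exists 1; rewrite ltry.
by rewrite lte_fin => a0; exists (a / 2); rewrite lte_fin; split; lra.
Qed.

Lemma lee_fin_approx {R : realType} (a b : \bar R) : (0 < a)%E ->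
  (forall s : R, 0 < s -> (s%:E < a)%E -> (s%:E <= b)%E) -> (a <= b)%E.
Proof.
move=> a0; case: b => [b| |] ab; first last.
- have [s [s0 sa]] := pos_fin_between a0.
  by have := ab s s0 sa.
- exact: leey.
case: a a0 ab => [a| |] // a0 ab.
- move: a0; rewrite lte_fin => a0; rewrite lee_fin leNgt; apply/negP => ba.
  have : a / 2 <= b by rewrite -lee_fin; apply: ab; rewrite ?lte_fin; lra.
  have := ab ((a + b) / 2); rewrite lee_fin lte_fin => {}ab.
  by move=> a2b; have := ab ltac:(lra) ltac:(lra); lra.
- have b1 : 1 <= b by rewrite -lee_fin; apply: ab; rewrite ?ltry.
  exfalso; have := ab (b + 1); rewrite ltry lee_fin => {}ab.
  by have := ab ltac:(lra) isT; lra.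
Qed.

(** The point given by Ekeland's principle must be a minimizer, for otherwise
    it would carry a Demyanov subgradient of norm at most [s]. The conclusion
    contains both the nonemptiness of [Argmin f] and the growth estimate. *)
Lemma exists_Argmin_near {R : realType} {X : completeNormedModType R}
    (f : X -> R) (s : R) :
  lower_semicontinuous (fun x => (f x)%:E) ->
  has_lbound [set f x | x in setT] ->
  (forall x, quasidifferentiable f x) -> 0 < s ->
  (s%:E < dist (@dual_norm R X) 0
              (\bigcup_(x in ~` Argmin f) demyanov_subdiff f x))%E ->
  forall x, exists a, Argmin f a /\ f a + s * `|a - x| <= f x.
Proof.
move=> f_lsc f_bd f_qd s0 s_lt x.
have [a [ax amin]] := ekeland x s0 f_lsc f_bd.
exists a; split => //; apply: contrapT => aA.
have [p [pf]] := small_demyanov_subgradient (ltW s0) (f_qd a) amin.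
rewrite leNgt => /negP; apply; apply: lt_le_trans s_lt _.
apply: ereal_inf_lbound; exists p; first by exists a.
rewrite /dual_norm; congr ereal_sup; apply/seteqP; split => _ [v v1 <-];
  exists v => //; by rewrite /= sub0r /GRing.opp/= normrN.
Qed.

Theorem theorem4p1 (R : realType) (X : completeNormedModType R) (f : X -> R)
    (f_lsc : lower_semicontinuous (fun x => (f x)%:E))
    (f_bounded_below : has_lbound [set f x | x in setT])
    (f_quasidiff : forall x : X, quasidifferentiable f x)
    (tau : \bar R)
    (tauE : dist (@dual_norm R X) 0
              (\bigcup_(x in ~` Argmin f) demyanov_subdiff f x) = tau)
    (tau_gt0 : (0 < tau)%E) :
  weak_sharp f /\ (tau <= wsha f)%E.
Proof.
have nearest (s : R) : 0 < s -> (s%:E < tau)%E ->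
    forall x, exists a, Argmin f a /\ f a + s * `|a - x| <= f x.
  by move=> s0 s_lt; apply: exists_Argmin_near; rewrite ?tauE.
have sharp (s : R) : 0 < s -> (s%:E < tau)%E -> weak_sharp_constant f s.
  move=> s0 s_lt; split => // x.
  have [a [Aa ax]] := nearest s s0 s_lt x.
  have xa : (dist (fun v : X => `|v|%:E) x (Argmin f) <= `|a - x|%:E)%E.
    by apply: ereal_inf_lbound; exists a => //; rewrite distrC.
  apply: (@le_trans _ _ (s%:E * `|a - x|%:E)%E).
    by rewrite lee_pmul2l// lte_fin.
  apply: (@le_trans _ _ ((f x)%:E - (f a)%:E)%E).
    by rewrite -EFinM -EFinB lee_fin; lra.
  by apply: leeB => //; apply: ereal_inf_lbound; exists a.
have [s [s0 s_lt]] := pos_fin_between tau_gt0.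
split.
  have [a [Aa _]] := nearest s s0 s_lt 0.
  by split; [exists a|exists s; exact: sharp].
apply: lee_fin_approx => // r r0 r_lt.
by apply: ereal_sup_ubound; exists r => //; exact: sharp.
Qed.
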